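(* Let $f:\mathbb{R}^n\to(-\infty,+\infty]$ be a proper closed function with $S=\arg\min f$ nonempty, let $\bar x\in S$, and let $\mathcal{M}$ be a $C^1$-smooth embedded submanifold containing $\bar x$ (with induced metric). Suppose $f$ is $C^1$-partly smooth and prox-regular around $\bar x$ relative to $\mathcal{M}$ with $0\in\operatorname{ri}\partial f(\bar x)$, and $f$ is subdifferentially continuous at $\bar x$. Then the following are equivalent: (i) there exist $\epsilon,\mu>0$ such that $\mu\,\operatorname{dist}(x,S)\le\operatorname{dist}(0,\partial f(x))$ for all $x\in B_\epsilon(\bar x)$; (ii) there exist $\epsilon,\mu>0$ such that $\mu\,\operatorname{dist}(x,S\cap\mathcal{M})\le\|\nabla_{\mathcal{M}}f(x)\|$ for all $x\in B_\epsilon(\bar x)\cap\mathcal{M}$.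
   Context: $\hat\partial f$ is the Fréchet and $\partial f$ the limiting subdifferential; $\operatorname{dist}(0,\emptyset)=+\infty$. Partial smoothness: $f$ is partly smooth at a point $x\in\mathcal M$ relative to a $C^p$ manifold $\mathcal{M}$ (for all subgradients) if: (Regularity) $\hat\partial f(z)=\partial f(z)\neq\varnothing$ for all $z\in\mathcal{M}$ near $x$; (Restricted smoothness) $f|_{\mathcal{M}}$ is $C^p$-smooth around $x$; (Sharpness) $\operatorname{par}\partial f(x)$ (subspace parallel to the affine hull) equals $N_x\mathcal{M}$; (Inner semicontinuity) for every $y\in\partial f(x)$ and every sequence $x_r\to x$ in $\mathcal{M}$ there exist $y_r\in\partial f(x_r)$ with $y_r\to y$. ''Around $\bar x$ relative to $\mathcal M$'' means at every point of $\mathcal M$ near $\bar x$ (with $p=1$). Prox-regularity of $f$ at $x$ for $\bar v\in\hat\partial f(x)$: there are $\epsilon>0,\rho\ge0$ with $f(x'')\ge f(x')+\langle v,x''-x'\rangle-\frac\rho2\|x''-x'\|^2$ for all $x',x''\in B_\epsilon(x)$, $v\in\hat\partial f(x')$ with $\|v-\bar v\|<\epsilon$ and $f(x')<f(x)+\epsilon$; ''prox-regular around $\bar x$ relative to $\mathcal M$'' is taken to mean prox-regular at every point of $\mathcal M$ near $\bar x$ for each of its subgradients. Subdifferential continuity at $\bar x$: $x_k\to\bar x$, $v_k\in\partial f(x_k)$, $v_k\to\bar v\in\partial f(\bar x)$ imply $f(x_k)\to f(\bar x)$. $\nabla_{\mathcal M}f$ is the Riemannian gradient of $f|_{\mathcal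 M}$. *)

(* Defs.v *)
From HB Require Import structures.
From mathcomp Require Import all_boot all_order all_algebra.
From mathcomp Require Import all_classical reals ereal.
Set Implicit Arguments. Unset Strict Implicit. Unset Printing Implicit Defensive.
Import Order.TTheory GRing.Theory Num.Theory.
Local Open Scope classical_set_scope.
Local Open Scope ring_scope.

Section Defs.
Variable R : realType.

Definition dot (k : nat) (u v : 'rV[R]_k) : R := \sum_(i < k) u ord0 i * v ord0 i.
Definition enorm (k : nat) (u : 'rV[R]_k) : R := Num.sqrt (dot u u).
Definition fnorm (k m : nat) (A : 'M[R]_(k, m)) : R :=
  Num.sqrt (\sum_(i < k) \sum_(j < m) A i j ^+ 2).

Variable n : nat.
Notation V := 'rV[R]_n.

Definition ball_e (x : V) (eps : R) : set V := [set y | enorm (y - x) < eps].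

Definition vcvg (u : nat -> V) (x : V) : Prop :=
  forall eps : R, 0 < eps -> exists N : nat, forall k, (N <= k)%N -> enorm (u k - x) < eps.
Definition rcvg (u : nat -> R) (a : R) : Prop :=
  forall eps : R, 0 < eps -> exists N : nat, forall k, (N <= k)%N -> `|u k - a| < eps.

(* distance to a set (in \bar R; dist(x, empty) = +oo) *)
Definition dist (x : V) (A : set V) : \bar R :=
  ereal_inf [set (enorm (x - a))%:E | a in A].

Definition proper_fun (f : V -> \bar R) : Prop :=
  (forall x, f x != -oo%E) /\ exists x, f x \is a fin_num.
Definition closed_fun (f : V -> \bar R) : Prop :=
  forall (x : V) (a : R), (a%:E < f x)%E ->
    exists2 d : R, 0 < d & forall y, enorm (y - x) < d -> (a%:E < f y)%E.

Definition argmin (f : V -> \bar R) : set V := [set x | forall y, (f x <= f y)%E].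

Definition fsub (f : V -> \bar R) (x : V) : set V :=
  [set v | f x \is a fin_num /\
     forall eps : R, 0 < eps -> exists2 d : R, 0 < d & forall y, enorm (y - x) < d ->
       ((fine (f x) + dot v (y - x) - eps * enorm (y - x))%:E <= f y)%E].

Definition lsub (f : V -> \bar R) (x : V) : set V :=
  [set v | f x \is a fin_num /\
     exists (xs vs : nat -> V), vcvg xs x /\ rcvg (fun k => fine (f (xs k))) (fine (f x))
       /\ (forall k, fsub f (xs k) (vs k)) /\ vcvg vs v].

Definition aff (C : set V) : set V :=
  [set v | exists (k : nat) (c : 'I_k -> V) (l : 'I_k -> R),
     (forall i, C (c i)) /\ \sum_(i < k) l i = 1 /\ v = \sum_(i < k) l i *: c i].
Definition par (C : set V) : set V :=
  [set v | exists (k : nat) (c : 'I_k -> V) (l : 'I_k -> R),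
     (forall i, C (c i)) /\ \sum_(i < k) l i = 0 /\ v = \sum_(i < k) l i *: c i].
Definition ri (C : set V) : set V :=
  [set z | C z /\ exists2 eps : R, 0 < eps & forall y, aff C y -> enorm (y - z) < eps -> C y].

Definition has_deriv (m : nat) (F : V -> 'rV[R]_m) (x : V) (J : 'M[R]_(n, m)) : Prop :=
  forall eps : R, 0 < eps -> exists2 d : R, 0 < d & forall y, enorm (y - x) < d ->
    enorm (F y - F x - (y - x) *m J) <= eps * enorm (y - x).
Definition C1_on (m : nat) (F : V -> 'rV[R]_m) (J : V -> 'M[R]_(n, m)) (z : V) (r : R) : Prop :=
  forall y, enorm (y - z) < r ->
    has_deriv F y (J y) /\
    (forall eps : R, 0 < eps -> exists2 d : R, 0 < d & forall y', enorm (y' - y) < d ->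
        fnorm (J y' - J y) < eps).

Definition C1_manifold (M : set V) : Prop :=
  forall z, M z -> exists (r : R) (m : nat) (F : V -> 'rV[R]_m) (J : V -> 'M[R]_(n, m)),
    0 < r /\ C1_on F J z r /\ row_full (J z) /\
    forall y, enorm (y - z) < r -> (M y <-> F y = 0).

Definition curve_vel (g : R -> V) (xi : V) : Prop :=
  forall eps : R, 0 < eps -> exists2 d : R, 0 < d & forall t : R, `|t| < d ->
    enorm (g t - g 0 - t *: xi) <= eps * `|t|.
Definition curve_in (M : set V) (x : V) (g : R -> V) : Prop :=
  g 0 = x /\ exists2 d : R, 0 < d & forall t : R, `|t| < d -> M (g t).

Definition tangent (M : set V) (x : V) : set V :=
  [set xi | exists g : R -> V, curve_in M x g /\ curve_vel g xi].
Definition normal (M : set V) (x : V) : set V :=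
  [set v | forall xi, tangent M x xi -> dot v xi = 0].

Definition restr_C1 (f : V -> \bar R) (M : set V) (x : V) : Prop :=
  exists (r : R) (g : V -> 'rV[R]_1) (J : V -> 'M[R]_(n, 1)),
    0 < r /\ C1_on g J x r /\
    forall y, M y -> enorm (y - x) < r -> f y = (g y ord0 ord0)%:E.

Definition is_rgrad (f : V -> \bar R) (M : set V) (x v : V) : Prop :=
  tangent M x v /\
  forall (g : R -> V) (xi : V), curve_in M x g -> curve_vel g xi ->
    (exists2 d : R, 0 < d & forall t : R, `|t| < d -> f (g t) \is a fin_num) /\
    (forall eps : R, 0 < eps -> exists2 d : R, 0 < d & forall t : R, `|t| < d ->
       `|fine (f (g t)) - fine (f x) - t * dot v xi| <= eps * `|t|).

Definition partly_smooth (f : V -> \bar R) (M : set V) (x : V) : Prop :=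
  M x /\
  (exists2 r : R, 0 < r & forall z, M z -> enorm (z - x) < r ->
       fsub f z = lsub f z /\ lsub f z !=set0) /\
  restr_C1 f M x /\
  par (lsub f x) = normal M x /\
  (forall y, lsub f x y -> forall xs : nat -> V, (forall k, M (xs k)) -> vcvg xs x ->
     exists ys : nat -> V, (forall k, lsub f (xs k) (ys k)) /\ vcvg ys y).

Definition prox_regular_at (f : V -> \bar R) (x vbar : V) : Prop :=
  exists (eps rho : R), 0 < eps /\ 0 <= rho /\
    forall x' x'' v, enorm (x' - x) < eps -> enorm (x'' - x) < eps ->
      fsub f x' v -> enorm (v - vbar) < eps -> (f x' < f x + eps%:E)%E ->
      ((fine (f x') + dot v (x'' - x') - rho / 2 * enorm (x'' - x') ^+ 2)%:E <= f x'')%E.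

Definition around_rel (P : V -> Prop) (M : set V) (xbar : V) : Prop :=
  exists2 r : R, 0 < r & forall z, M z -> enorm (z - xbar) < r -> P z.

Definition subdiff_continuous (f : V -> \bar R) (xbar : V) : Prop :=
  forall (xs vs : nat -> V) (vbar : V), vcvg xs xbar -> (forall k, lsub f (xs k) (vs k)) ->
    vcvg vs vbar -> lsub f xbar vbar -> rcvg (fun k => fine (f (xs k))) (fine (f xbar)).

End Defs.

(* Main.v *)
From HB Require Import structures.
From mathcomp Require Import all_boot all_order all_algebra.
From mathcomp Require Import ring lra.
From mathcomp Require Import all_classical reals ereal.
From mathcomp Require Import topology normedtype.
Require Import Defs.
Import Order.TTheory GRing.Theory Num.Theory.
Import numFieldNormedType.Exports.
Set Implicit Arguments. Unset Strict Implicit. Unset Printing Implicit Defensive.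
Local Open Scope classical_set_scope.
Local Open Scope ring_scope.

(** On [M] every subgradient [v] at [x] has the Riemannian gradient as its
    tangential part, so [enorm (grad f) <= enorm v].  Two facts then compare the
    error bounds.

    Since [0] is in the relative interior of the subdifferential at [xbar], inner
    semicontinuity and compactness of unit normals give, near [xbar], subgradients
    close to [e u] for every unit normal [u].  Hence the Riemannian gradient is
    itself a subgradient: otherwise the direction from its nearest subgradient to
    it would be a normal [u] with [dot y u <= 0] for all subgradients [y].

    Identification: a point [x] near [xbar] carrying a small subgradient [v] lies
    on [M].  Otherwise let [p] be its projection and [u] the direction of [x - p];
    prox-regularity at the pairs [(p, y)] with [y] close to [e u], and [(x, v)],
    gives [dot (y - v) (x - p) <= rho |x - p|^2], impossible for [|x - p|] small.
    In particular minimisers near [xbar] lie on [M].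

    Tangent spaces are identified with kernels of the defining equations through
    a Lyusternik-Graves estimate obtained by minimisation, without an implicit
    function theorem. *)

(** * Euclidean norm and sequential compactness *)

Section Euclid.
Variables (R : realType) (k : nat).
Implicit Types (u v w : 'rV[R]_k) (a : R).

Lemma dotC u v : dot u v = dot v u.
Proof. by apply: eq_bigr => i _; rewrite mulrC. Qed.

Lemma dotDl u v w : dot (u + v) w = dot u w + dot v w.
Proof. by rewrite -big_split; apply: eq_bigr => i _; rewrite mxE mulrDl. Qed.

Lemma dotZl a u v : dot (a *: u) v = a * dot u v.
Proof. by rewrite mulr_sumr; apply: eq_bigr => i _; rewrite mxE mulrA. Qed.

Lemma dotNl u v : dot (- u) v = - dot u v.
Proof. by rewrite -scaleN1r dotZl mulN1r. Qed.

Lemma dotBl u v w : dot (u - v) w = dot u w - dot v w.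
Proof. by rewrite dotDl dotNl. Qed.

Lemma dotDr u v w : dot u (v + w) = dot u v + dot u w.
Proof. by rewrite dotC dotDl !(dotC _ u). Qed.

Lemma dotZr a u v : dot u (a *: v) = a * dot u v.
Proof. by rewrite dotC dotZl dotC. Qed.

Lemma dotNr u v : dot u (- v) = - dot u v.
Proof. by rewrite dotC dotNl dotC. Qed.

Lemma dotBr u v w : dot u (v - w) = dot u v - dot u w.
Proof. by rewrite dotDr dotNr. Qed.

Lemma dot0l u : dot 0 u = 0.
Proof. by rewrite -(scale0r 0) dotZl mul0r. Qed.

Lemma dot0r u : dot u 0 = 0.
Proof. by rewrite dotC dot0l. Qed.

Lemma dot_ge0 u : 0 <= dot u u.
Proof. by apply: sumr_ge0 => i _; rewrite -expr2 sqr_ge0. Qed.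

Lemma enorm_ge0 u : 0 <= enorm u.
Proof. exact: sqrtr_ge0. Qed.

Lemma enorm_sqr u : enorm u ^+ 2 = dot u u.
Proof. by rewrite sqr_sqrtr // dot_ge0. Qed.

Lemma enorm0 : enorm (0 : 'rV[R]_k) = 0.
Proof. by rewrite /enorm dot0l sqrtr0. Qed.

Lemma enorm_eq0 u : enorm u = 0 -> u = 0.
Proof.
move=> u0; have := enorm_sqr u; rewrite u0 expr0n /= => /esym/eqP.
rewrite psumr_eq0 => [|i _]; last by rewrite -expr2 sqr_ge0.
move=> /allP h; apply/rowP => i; rewrite mxE; apply/eqP.
by have := h i (mem_index_enum i); rewrite -expr2 sqrf_eq0 /=.
Qed.

Lemma enorm_gt0 u : u != 0 -> 0 < enorm u.
Proof.
move=> u0; rewrite lt_def enorm_ge0 andbT.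
by apply: contra u0 => /eqP/enorm_eq0 ->.
Qed.

Lemma enormZ a u : enorm (a *: u) = `|a| * enorm u.
Proof.
rewrite /enorm dotZl dotZr mulrA -expr2 sqrtrM ?sqr_ge0 //.
by rewrite sqrtr_sqr.
Qed.

Lemma enormN u : enorm (- u) = enorm u.
Proof. by rewrite -scaleN1r enormZ normrN1 mul1r. Qed.

Lemma enormBC u v : enorm (u - v) = enorm (v - u).
Proof. by rewrite -enormN opprB. Qed.

Lemma dot_le u v : dot u v <= enorm u * enorm v.
Proof.
have [->|u0] := eqVneq u 0; first by rewrite dot0l enorm0 mul0r.
have [->|v0] := eqVneq v 0; first by rewrite dot0r enorm0 mulr0.
have pu := enorm_gt0 u0; have pv := enorm_gt0 v0.
have := dot_ge0 (enorm v *: u - enorm u *: v).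
rewrite dotBl !dotBr !dotZl !dotZr -!enorm_sqr (dotC v u) => h.
have {h} : 0 <= (enorm u * enorm v) * (2 * (enorm u * enorm v - dot u v)) by nra.
by rewrite pmulr_rge0 ?mulr_gt0 // pmulr_rge0 // subr_ge0.
Qed.

Lemma dot_norm_le u v : `|dot u v| <= enorm u * enorm v.
Proof. by rewrite ler_norml dot_le lerNl -dotNl -(enormN u) dot_le. Qed.

Lemma enormD u v : enorm (u + v) <= enorm u + enorm v.
Proof.
rewrite -(@ler_pXn2r _ 2) ?nnegrE ?addr_ge0 ?enorm_ge0 //.
rewrite enorm_sqr dotDl !dotDr (dotC v u) sqrrD -!enorm_sqr.
by have := dot_le u v; lra.
Qed.

Lemma enorm_triangle v u w : enorm (u - w) <= enorm (u - v) + enorm (v - w).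
Proof. by rewrite -[u - w](subrKA v) enormD. Qed.

Lemma enorm_le_triangle u v : enorm u <= enorm (u - v) + enorm v.
Proof. by have := enorm_triangle v u 0; rewrite !subr0. Qed.

Lemma enorm_small u : (forall eps : R, 0 < eps -> enorm u <= eps) -> u = 0.
Proof.
move=> h; apply: enorm_eq0; apply/eqP; rewrite eq_le enorm_ge0 andbT.
by apply/ler_addgt0Pr => e e0; rewrite add0r h.
Qed.

Lemma coord_le_enorm u i : `|u ord0 i| <= enorm u.
Proof.
rewrite -sqrtr_sqr; apply: ler_wsqrtr; rewrite /dot (bigD1 i) //= expr2 lerDl.
by apply: sumr_ge0 => j _; rewrite -expr2 sqr_ge0.
Qed.

Lemma enorm_le_coord u a : 0 <= a -> (forall i, `|u ord0 i| <= a) ->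
  enorm u <= k%:R * a.
Proof.
move=> a0 h; rewrite -(@ler_pXn2r _ 2) ?nnegrE ?enorm_ge0 ?mulr_ge0 ?ler0n //.
rewrite enorm_sqr (@le_trans _ _ (\sum_(i < k) a ^+ 2)) //.
  by apply: ler_sum => i _; rewrite -expr2 -real_normK ?num_real // ler_pXn2r ?nnegrE ?normr_ge0.
rewrite sumr_const card_ord -[leLHS]mulr_natl exprMn ler_wpM2r ?sqr_ge0 //.
by rewrite -natrX ler_nat; case: (k) => // l; rewrite expnS leq_pmulr.
Qed.

End Euclid.

Lemma enorm_mulmx (R : realType) (k m : nat) (u : 'rV[R]_k) (A : 'M[R]_(k, m)) :
  enorm (u *m A) <= enorm u * fnorm A.
Proof.
rewrite -(@ler_pXn2r _ 2) ?nnegrE ?enorm_ge0 ?mulr_ge0 ?enorm_ge0 ?sqrtr_ge0 //.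
have A0 : 0 <= \sum_(i < k) \sum_(j < m) A i j ^+ 2.
  by apply: sumr_ge0 => i _; apply: sumr_ge0 => j _; rewrite sqr_ge0.
rewrite enorm_sqr exprMn [fnorm A ^+ 2]sqr_sqrtr // exchange_big mulr_sumr.
apply: ler_sum => j _; rewrite -expr2.
have -> : (u *m A) ord0 j = dot u (\row_i A i j).
  by rewrite mxE; apply: eq_bigr => i _; rewrite mxE.
rewrite -real_normK ?num_real //.
rewrite (@le_trans _ _ ((enorm u * enorm (\row_i A i j)) ^+ 2)) //.
  by rewrite ler_pXn2r ?nnegrE ?mulr_ge0 ?enorm_ge0 ?dot_norm_le.
rewrite exprMn (enorm_sqr (\row_i _)) ler_wpM2l ?sqr_ge0 //.
by apply: ler_sum => i _; rewrite !mxE expr2.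
Qed.

Section Sequences.
Variables (R : realType) (k : nat).
Implicit Types (u v : nat -> 'rV[R]_k) (x y : 'rV[R]_k).

Lemma vcvg_const x : vcvg (fun=> x) x.
Proof. by move=> e e0; exists 0%N => j _; rewrite subrr enorm0. Qed.

Lemma vcvg_sub u x (p : nat -> nat) :
  (forall j, (j <= p j)%N) -> vcvg u x -> vcvg (fun j => u (p j)) x.
Proof.
move=> hp ux e /ux[N hN]; exists N => j Nj; apply: hN.
exact: leq_trans Nj (hp j).
Qed.

Lemma vcvg_inv u x : (forall j, enorm (u j - x) < j.+1%:R^-1) -> vcvg u x.
Proof.
move=> h e e0; exists (Num.truncn e^-1) => j hj; apply: lt_trans (h j) _.
rewrite invf_plt ?posrE //; apply: lt_le_trans (truncnS_gt _) _.
by rewrite ler_nat.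
Qed.

(** A bounded sequence stays in a compact box, hence has a cluster point. The index map only
    satisfies [j <= p j] and need not be monotone; this is enough to pass to limits along it. *)
Lemma bolzano_weierstrass u (B : R) : (forall j, enorm (u j) <= B) ->
  exists (p : nat -> nat) (x : 'rV[R]_k),
    (forall j, (j <= p j)%N) /\ vcvg (fun j => u (p j)) x.
Proof.
move=> uB.
have cpt : compact [set w : 'rV[R]_k | forall i, w ord0 i \in `[- B, B]].
  by apply: (@rV_compact _ _ (fun=> [set` `[- B, B]])) => _; exact: segment_compact.
have [|x [_ xcl]] := cpt (u @ \oo) _.
  exists 0%N => // j _ i /=; rewrite in_itv /= -ler_norml.
  exact: le_trans (coord_le_enorm _ _) (uB j).
have near (j : nat) : exists l, (j <= l)%N /\ enorm (u l - x) < j.+1%:R^-1.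
  (* Balls of the ambient topology are taken coordinatewise, and passing to the Euclidean norm costs
     a factor [k]; dividing by [k.+1] also covers [k = 0]. *)
  have e0 : 0 < j.+1%:R^-1 / k.+1%:R :> R by rewrite divr_gt0 ?invr_gt0.
  have [|w [[l /= jl <-] hw]] := xcl [set u l | l in [set l | (j <= l)%N]]
      (ball x (j.+1%:R^-1 / k.+1%:R)) _ (nbhsx_ballx _ _ e0).
    by exists j => // l /= jl; exists l.
  exists l; split=> //; apply: le_lt_trans (_ : k%:R * (j.+1%:R^-1 / k.+1%:R) < _).
    apply: enorm_le_coord; first exact: ltW.
    by move=> i; case: hw => _ /(_ ord0 i); rewrite -ball_normE /= !mxE distrC; exact: ltW.
  by rewrite mulrCA gtr_pMr ?invr_gt0 // ltr_pdivrMr // mul1r ltr_nat.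
have [p hp] := choice near; exists p, x; split=> [j|]; first by case: (hp j).
by apply: vcvg_inv => j; case: (hp j).
Qed.

Definition vclosed (A : set 'rV[R]_k) : Prop :=
  forall u x, (forall j, A (u j)) -> vcvg u x -> A x.

(** A minimising sequence clusters in the bounded closed set [A], and the last hypothesis, lower
    semicontinuity on [A], shows that the cluster point attains the infimum. *)
Lemma extreme_value (A : set 'rV[R]_k) (h : 'rV[R]_k -> R) (B : R) :
  A !=set0 -> (forall y, A y -> enorm y <= B) -> vclosed A ->
  (forall y, 0 <= h y) ->
  (forall y, A y -> forall e : R, 0 < e -> exists2 d : R, 0 < d &
     forall z, A z -> enorm (z - y) < d -> h y <= h z + e) ->
  exists2 y, A y & forall z, A z -> h y <= h z.
Proof.
move=> [a0 Aa0] AB Acl h0 hc.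
pose m := inf [set h y | y in A].
have lbm y : A y -> m <= h y.
  move=> Ay; apply: ge_inf; last by exists y.
  by exists 0 => _ [z _ <-].
have app j : exists y, A y /\ h y < m + j.+1%:R^-1.
  have : m < m + j.+1%:R^-1 by rewrite ltrDl invr_gt0.
  have nA : [set h y | y in A] !=set0 by exists (h a0); exists a0.
  by move=> /(inf_lt nA)[_ [y Ay <-] hy]; exists y.
have [u hu] := choice app.
have Au j : A (u j) by case: (hu j).
have [|p [x [hp ux]]] := @bolzano_weierstrass u B; first by move=> j; exact: AB.
have Ax : A x by apply: Acl ux => j.
exists x => // z Az; apply: le_trans (lbm z Az).
suff he (e : R) : 0 < e -> h x <= m + e by apply/ler_addgt0Pr.
move=> e0; have [|d d0 hd] := hc x Ax (e / 2); first by rewrite divr_gt0.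
have [N1 hN1] := ux d d0.
pose j := maxn N1 (Num.truncn (e / 2)^-1).
have hxj : h x <= h (u (p j)) + e / 2 by apply: hd => //; exact: hN1 (leq_maxl _ _).
have [_ hj] := hu (p j).
have hpj : (p j).+1%:R^-1 < e / 2.
  rewrite invf_plt ?posrE ?divr_gt0 //; apply: lt_le_trans (truncnS_gt _) _.
  by rewrite ler_nat ltnS (leq_trans _ (hp j)) // leq_maxr.
move: hxj hj hpj; set q := (p j).+1%:R^-1; lra.
Qed.

Lemma nearest_point (A : set 'rV[R]_k) x : A !=set0 -> vclosed A ->
  exists2 p, A p & forall z, A z -> enorm (x - p) <= enorm (x - z).
Proof.
move=> [a Aa] Acl.
(* Points farther from [x] than [a] cannot compete; discarding them makes the set bounded. *)
pose A' := A `&` [set z | enorm (x - z) <= enorm (x - a)].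
have [||||//|p [Ap _] hp] := @extreme_value A' (fun z => enorm (x - z))
    (enorm x + enorm (x - a)).
- by exists a; split=> //=.
- move=> y [_ /= hy]; have := enorm_le_triangle y x; rewrite enormBC; lra.
- move=> u y hu uy; split; first by apply: Acl uy => j; case: (hu j).
  suff he (e : R) : 0 < e -> enorm (x - y) <= enorm (x - a) + e by apply/ler_addgt0Pr.
  move=> /uy[N /(_ N (leqnn N)) hN].
  have [_ /= hj] := hu N; have := enorm_triangle (u N) x y; lra.
- by move=> y; exact: enorm_ge0.
- move=> y _ e e0; exists e => // z _ hz; have := enorm_triangle z x y; lra.
exists p => // z Az; case: (lerP (enorm (x - z)) (enorm (x - a))) => hz.
  exact: hp.
by apply: le_trans (hp a _) (ltW hz); split=> //=.
Qed.

End Sequences.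

(** * Tangent and normal spaces of a manifold *)

Lemma fnorm_ge0 (R : realType) (k m : nat) (A : 'M[R]_(k, m)) : 0 <= fnorm A.
Proof. exact: sqrtr_ge0. Qed.

(** The added [1] keeps the denominator large enough for all three bounds, with no case split on
    [b = 0]. *)
Lemma small_step (R : realType) (a b : R) : 0 < a -> 0 <= b ->
  exists s : R, [/\ 0 < s, s <= 1 & s * b < a].
Proof.
move=> a0 b0; exists (a / (a + b + 1)); split.
- by rewrite divr_gt0 //; lra.
- by rewrite ler_pdivrMr; lra.
- by rewrite mulrAC ltr_pdivrMr; nra.
Qed.

(** The one-sided bound is tested at [t] and at [- t], which bounds [c] from both sides. This is how
    first-order inequalities along curves become equalities. *)
Lemma little_o_eq0 (R : realType) (c : R) :
  (forall e : R, 0 < e -> exists2 d : R, 0 < d &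
     forall t, `|t| < d -> t * c <= e * `|t|) -> c = 0.
Proof.
move=> h; apply/eqP; rewrite -normr_eq0 eq_le normr_ge0 andbT.
suff he (e : R) : 0 < e -> `|c| <= 0 + e by apply/ler_addgt0Pr.
move=> e0; rewrite add0r; have [d d0 hd] := h e e0.
have d20 : 0 < d / 2 by rewrite divr_gt0.
have := hd (d / 2); have := hd (- (d / 2)).
rewrite normrN gtr0_norm // => /(_ ltac:(lra)) hn /(_ ltac:(lra)).
rewrite mulrC ler_pM2r // => hp.
move: hn; rewrite mulNr -mulrN mulrC ler_pM2r // => hn.
by rewrite ler_norml; apply/andP; split; lra.
Qed.

Section Curves.
Variables (R : realType) (n : nat).
Notation V := 'rV[R]_n.
Implicit Types (x y xi : V) (g : R -> V).

Lemma has_deriv_continuous m (F : V -> 'rV[R]_m) y J : has_deriv F y J ->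
  forall e : R, 0 < e -> exists2 d : R, 0 < d &
    forall z, enorm (z - y) < d -> enorm (F z - F y) < e.
Proof.
move=> FJ e e0; have [d d0 hd] := FJ 1 ltr01.
have [||s [s0 s1 hs]] := @small_step _ e (1 + fnorm J) => //.
  by rewrite addr_ge0 ?fnorm_ge0.
exists (Num.min d s); first by rewrite lt_min d0.
move=> z; rewrite lt_min => /andP[zd zs]; have := hd z zd; rewrite mul1r => h.
have := enorm_le_triangle (F z - F y) ((z - y) *m J).
have := enorm_mulmx (z - y) J; have := fnorm_ge0 J.
by move: (enorm_ge0 (z - y)) => *; nra.
Qed.

Lemma curve_vel_lipschitz g xi : curve_vel g xi ->
  exists2 d : R, 0 < d &
    forall t, `|t| < d -> enorm (g t - g 0) <= (enorm xi + 1) * `|t|.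
Proof.
move=> /(_ 1 ltr01)[d d0 hd]; exists d => // t /hd.
by have := enorm_le_triangle (g t - g 0) (t *: xi); rewrite enormZ; lra.
Qed.

Lemma curve_vel_near g xi : curve_vel g xi -> forall e : R, 0 < e ->
  exists2 d : R, 0 < d & forall t, `|t| < d -> enorm (g t - g 0) < e.
Proof.
move=> /curve_vel_lipschitz[d d0 hd] e e0.
have [||s [s0 s1 hs]] := @small_step _ e (enorm xi + 1) => //.
  by rewrite addr_ge0 ?enorm_ge0.
exists (Num.min d s); first by rewrite lt_min d0.
move=> t; rewrite lt_min => /andP[/hd h ts]; apply: le_lt_trans h _.
by have := enorm_ge0 xi; nra.
Qed.

(** The chain rule along a curve: half of [e] pays for the linearisation of [F], half for that of
    [g]. *)
Lemma has_deriv_curve m (F : V -> 'rV[R]_m) x J g xi :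
  has_deriv F x J -> g 0 = x -> curve_vel g xi ->
  forall e : R, 0 < e -> exists2 d : R, 0 < d & forall t, `|t| < d ->
    enorm (F (g t) - F x - t *: (xi *m J)) <= e * `|t|.
Proof.
move=> FJ g0 gxi e e0.
have xi1 : 0 < enorm xi + 1 by have := enorm_ge0 xi; lra.
have J1 : 0 < fnorm J + 1 by have := fnorm_ge0 J; lra.
have [|d1 d10 h1] := FJ (e / 2 / (enorm xi + 1)); first by rewrite !divr_gt0.
have [|d2 d20 h2] := gxi (e / 2 / (fnorm J + 1)); first by rewrite !divr_gt0.
have [d3 d30 h3] := curve_vel_lipschitz gxi.
have [d4 d40 h4] := curve_vel_near gxi d10.
exists (Num.min d2 (Num.min d3 d4)); first by rewrite !lt_min d20 d30.
move=> t; rewrite !lt_min => /and3P[/h2 k2 /h3 k3 /h4 k4].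
rewrite g0 in k2 k3 k4.
have k1 := h1 _ k4.
have k5 : e / 2 / (enorm xi + 1) * enorm (g t - x) <= e / 2 * `|t|.
  rewrite (le_trans (ler_wpM2l _ k3)) ?mulrA ?divfK ?gt_eqF //.
  by rewrite ltW // !divr_gt0.
have k6 : enorm ((g t - x - t *: xi) *m J) <= e / 2 * `|t|.
  rewrite (le_trans (enorm_mulmx _ _)) //.
  rewrite (le_trans (ler_wpM2r (fnorm_ge0 J) k2)) // mulrAC ler_wpM2r //.
  rewrite mulrAC ler_pdivrMr // ler_wpM2l ?ltW ?divr_gt0 //; lra.
have -> : F (g t) - F x - t *: (xi *m J) =
    (F (g t) - F x - (g t - x) *m J) + (g t - x - t *: xi) *m J.
  by rewrite (mulmxBl (g t - x)) -scalemxAl subrKA.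
by have := enormD (F (g t) - F x - (g t - x) *m J) ((g t - x - t *: xi) *m J); lra.
Qed.

End Curves.

Section Manifold.
Variables (R : realType) (n : nat).
Notation V := 'rV[R]_n.
Implicit Types (M : set V) (x y z xi : V).

(* [K] is a right inverse of the differential at [z], hence an approximate one
   nearby; it serves in place of the Moore-Penrose inverse of [J y]. *)
Definition chart M z (r : R) m (F : V -> 'rV[R]_m) (J : V -> 'M[R]_(n, m))
    (K : 'M[R]_(m, n)) : Prop :=
  [/\ 0 < r,
      forall y, enorm (y - z) < r -> has_deriv F y (J y),
      forall y, enorm (y - z) < r -> (M y <-> F y = 0),
      forall y, enorm (y - z) < r -> forall l : 'rV[R]_m,
        enorm (l *m K *m J y - l) <= enorm l / 2 &
      forall e : R, 0 < e -> exists2 d : R, 0 < d &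
        forall y, enorm (y - z) < d -> fnorm (J y - J z) < e].

Lemma chart_exists M z : C1_manifold M -> M z ->
  exists (r : R) m (F : V -> 'rV[R]_m) J K, chart M z r F J K.
Proof.
move=> Mm Mz; have [r [m [F [J [r0 [FJ [Jz MF]]]]]]] := Mm z Mz.
have /row_fullP[K KJ] := Jz.
have [|_ Jc] := FJ z; first by rewrite subrr enorm0.
have K1 : 0 < fnorm K + 1 by have := fnorm_ge0 K; lra.
have [|d d0 hd] := Jc (2^-1 / (fnorm K + 1)); first by rewrite divr_gt0.
exists (Num.min r d), m, F, J, K; split=> //.
- by rewrite lt_min r0.
- by move=> y; rewrite lt_min => /andP[/FJ[]].
- by move=> y; rewrite lt_min => /andP[/MF].
- move=> y; rewrite lt_min => /andP[_ /hd h] l.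
  (* Since [K *m J z] is the identity, the residual sees only the variation of [J], and [d] makes
     that at most half after multiplication by the norm of [K]. *)
  have -> : l *m K *m J y - l = l *m K *m (J y - J z).
    by rewrite mulmxBr -(mulmxA l K (J z)) KJ mulmx1.
  rewrite (le_trans (enorm_mulmx _ _)) //.
  rewrite (le_trans (ler_wpM2r (fnorm_ge0 _) (enorm_mulmx _ _))) //.
  rewrite -mulrA ler_wpM2l ?enorm_ge0 //.
  rewrite (le_trans (ler_wpM2l (fnorm_ge0 _) (ltW h))) //.
  by rewrite mulrCA ler_piMr // ler_pdivrMr // mul1r; lra.
Qed.

Section Chart.
Variables (M : set V) (z : V) (r : R) (m : nat) (F : V -> 'rV[R]_m).
Variables (J : V -> 'M[R]_(n, m)) (K : 'M[R]_(m, n)).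

Lemma chart_closed : chart M z r F J K -> forall u y, (forall j, M (u j)) ->
  enorm (y - z) < r -> vcvg u y -> M y.
Proof.
move=> [r0 FJ MF _ _] u y Mu yr uy; apply/MF => //.
apply: enorm_small => e e0.
have [d d0 hd] := has_deriv_continuous (FJ y yr) e0.
have [|N hN] := uy (Num.min d (r - enorm (y - z))).
  by rewrite lt_min d0 subr_gt0.
have := hN N (leqnn N); rewrite lt_min => /andP[/hd h1 h2].
have FuN : F (u N) = 0.
  by apply/MF => //; have := enorm_triangle y (u N) z; lra.
by move: h1; rewrite FuN sub0r enormN => /ltW.
Qed.

(* The Lyusternik-Graves estimate: at a minimiser of [C |F y| + |y - y0|] with
   [F y != 0], the step along [- F y *m K] would decrease the objective. *)
Lemma lyusternik : chart M z r F J K -> exists2 C : R, 0 < C &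
  forall y0, enorm (y0 - z) < r / 2 -> C * enorm (F y0) < r / 2 ->
  exists2 y, M y & enorm (y - y0) <= C * enorm (F y0).
Proof.
move=> [r0 FJ MF KJ _]; have fK := fnorm_ge0 K.
(* The step below lowers the norm of [F] by [s / 4] of itself; [C] is large enough for this gain to
   outweigh the length of the step. *)
pose C := 4 * (1 + fnorm K); have C0 : 0 < C by rewrite /C; lra.
exists C => // y0 y0r Fy0.
pose A := [set y | enorm (y - y0) <= C * enorm (F y0)].
have Ar y : A y -> enorm (y - z) < r.
  by move=> Ay; have := enorm_triangle y0 y z; rewrite /A /= in Ay; lra.
have CF0 : 0 <= C * enorm (F y0) by rewrite mulr_ge0 ?enorm_ge0 ?ltW.
have [|||||y Ay hy] := @extreme_value _ _ A
    (fun y => C * enorm (F y) + enorm (y - y0)) (enorm y0 + C * enorm (F y0)).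
- by exists y0; rewrite /A /= subrr enorm0.
- by move=> y Ay; have := enorm_le_triangle y y0; rewrite /A /= in Ay; lra.
- move=> u y Au uy; rewrite /A /=.
  suff he (e : R) : 0 < e -> enorm (y - y0) <= C * enorm (F y0) + e.
    by apply/ler_addgt0Pr.
  move=> /uy[N /(_ N (leqnn N)) hN]; have := Au N; rewrite /A /=.
  by have := enorm_triangle (u N) y y0; rewrite (enormBC y (u N)); lra.
- by move=> y; apply: addr_ge0 (enorm_ge0 _); apply: mulr_ge0 (enorm_ge0 _); exact: ltW.
- move=> y /Ar yr e e0.
  have [|d d0 hd] := @has_deriv_continuous _ _ _ _ _ _ (FJ y yr) (e / 2 / C).
    by rewrite !divr_gt0.
  exists (Num.min d (e / 2)); first by rewrite lt_min d0 divr_gt0.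
  move=> w _; rewrite lt_min => /andP[/hd h1 h2].
  move: h1; rewrite ltr_pdivlMr // => h1.
  have := enorm_triangle w y y0; rewrite (enormBC y w).
  have := enorm_le_triangle (F y) (F w); rewrite (enormBC (F y) (F w)) => h3.
  have : C * enorm (F y) <= C * (enorm (F w - F y) + enorm (F w)).
    by rewrite ler_wpM2l // ltW.
  by lra.
exists y => //; have yr := Ar _ Ay; apply/MF => //.
have hy0 : C * enorm (F y) + enorm (y - y0) <= C * enorm (F y0).
  by have := hy y0; rewrite /A /= subrr enorm0 addr0; apply.
have [//|w0] := eqVneq (F y) 0; exfalso.
set w := F y in w0 hy0 *; have nw := enorm_gt0 w0.
have Cw : 0 < C * enorm w by rewrite mulr_gt0.
have K1 : 0 < 4 * (1 + fnorm K) by lra.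
have [|d d0 hd] := FJ y yr (4 * (1 + fnorm K))^-1; first by rewrite invr_gt0.
(* The step must be short enough for the derivative estimate, and shorter than the slack
   [C * enorm w] left by [hy0], so that [y'] stays in [A]. *)
have [||s [s0 s1]] := @small_step _ (Num.min d (C * enorm w)) (enorm (w *m K)).
- by rewrite lt_min d0.
- exact: enorm_ge0.
rewrite lt_min => /andP[hs1 hs2].
pose y' := y - s *: (w *m K).
have yy' : y' - y = - (s *: (w *m K)) by rewrite /y' addrAC subrr add0r.
have ny : enorm (y' - y) = s * enorm (w *m K).
  by rewrite yy' enormN enormZ gtr0_norm.
have wK := enorm_mulmx w K.
have Ay' : A y'.
  by have := enorm_triangle y y' y0; rewrite /A /= ny; lra.
have := hy y' Ay'; apply/negP; rewrite -ltNge.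
have h1 : enorm (F y' - w - (y' - y) *m J y) <= s * (enorm w / 4).
  apply: le_trans (hd y' _) _; first by rewrite ny.
  rewrite ny mulrCA ler_wpM2l ?(ltW s0) // mulrC ler_pdivrMr //; lra.
(* The exact Newton direction would give the factor [1 - s]; the approximate inverse loses [s / 2],
   and the linearisation error [h1] loses a further [s / 4]. *)
have h2 : enorm (w + (y' - y) *m J y) <= (1 - s / 2) * enorm w.
  have -> : w + (y' - y) *m J y = (1 - s) *: w - s *: (w *m K *m J y - w).
    by rewrite yy' mulNmx -scalemxAl scalerBl scale1r scalerBr opprB addrA subrK.
  apply: le_trans (enormD _ _) _; rewrite enormN !enormZ.
  rewrite (gtr0_norm s0) ger0_norm; last by lra.
  by have := KJ y yr w; nra.
have h3 : enorm (F y') <= (1 - s / 4) * enorm w.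
  have := enorm_le_triangle (F y') (w + (y' - y) *m J y).
  by rewrite opprD addrA; lra.
have h4 := enorm_triangle y y' y0.
have h5 : C * enorm (F y') <= C * ((1 - s / 4) * enorm w).
  by rewrite ler_wpM2l // ltW.
have h6 : s * enorm (w *m K) < s * (enorm w * (1 + fnorm K)).
  by rewrite ltr_pM2l //; lra.
have h7 : C * ((1 - s / 4) * enorm w) = C * enorm w - s * (enorm w * (1 + fnorm K)).
  by rewrite /C; field.
by rewrite ny in h4; lra.
Qed.

(** Along a curve in [M] the map [F] vanishes, so its derivative kills the velocity. Conversely, if
    [xi] is in the kernel, [F] is of order o(t) on the line [x + t *: xi], and [lyusternik] moves
    the line onto [M] by o(t), which leaves the velocity unchanged. *)
Lemma tangent_kernel : chart M z r F J K -> forall x xi, M x ->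
  enorm (x - z) < r / 2 -> tangent M x xi <-> xi *m J x = 0.
Proof.
move=> ch x xi Mx xr.
have [C C0 hC] := lyusternik ch; case: ch => r0 FJ MF KJ _.
have xr' : enorm (x - z) < r by lra.
have Fx : F x = 0 by apply/MF.
split=> [[g [[g0 [d0 d00 hd0]] gxi]]|xiJ].
- apply: enorm_small => e e0.
  have [d1 d10 h1] := has_deriv_curve (FJ x xr') g0 gxi e0.
  have [|d2 d20 h2] := @curve_vel_near _ _ _ _ gxi (r / 2); first by lra.
  pose t := Num.min d0 (Num.min d1 d2) / 2.
  have t0 : 0 < t by rewrite divr_gt0 // !lt_min d00 d10.
  have : `|t| < Num.min d0 (Num.min d1 d2).
    by rewrite gtr0_norm //; rewrite /t in t0 *; lra.
  rewrite !lt_min => /and3P[/hd0 Mg /h1 k1 /h2 k2].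
  have Fg : F (g t) = 0.
    apply/MF => //; rewrite g0 in k2.
    by have := enorm_triangle x (g t) z; lra.
  move: k1; rewrite Fg Fx subr0 sub0r enormN enormZ mulrC ler_pM2r //.
  by rewrite normr_gt0 gt_eqF.
- have step (t : R) : exists y, enorm (x + t *: xi - z) < r / 2 ->
      C * enorm (F (x + t *: xi)) < r / 2 ->
      M y /\ enorm (y - (x + t *: xi)) <= C * enorm (F (x + t *: xi)).
    (* Where the estimate does not apply the value [0] is arbitrary: only small [t] matter. *)
    have [h1|h1] := pselect (enorm (x + t *: xi - z) < r / 2); last by exists 0.
    have [h2|h2] := pselect (C * enorm (F (x + t *: xi)) < r / 2); last by exists 0.
    by have [y My hy] := hC _ h1 h2; exists y.
  have [g hg] := choice step.
  have sx (t : R) : enorm (x + t *: xi - x) = `|t| * enorm xi.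
    by rewrite addrC addKr enormZ.
  have ok : exists2 d : R, 0 < d & forall t, `|t| < d ->
      M (g t) /\ enorm (g t - (x + t *: xi)) <= C * enorm (F (x + t *: xi)).
    have [|d1 d10 h1] := @has_deriv_continuous _ _ _ _ _ _ (FJ x xr') (r / 2 / C).
      by rewrite !divr_gt0.
    have [||s [s0 s1 hs]] := @small_step _ (Num.min d1 (r / 2 - enorm (x - z)))
        (enorm xi); rewrite ?enorm_ge0 ?lt_min ?d10 ?subr_gt0 //.
    move: hs; rewrite lt_min => /andP[hs1 hs2].
    exists s => // t ts.
    have ts' : `|t| * enorm xi <= s * enorm xi by rewrite ler_wpM2r ?enorm_ge0 ?ltW.
    apply: hg.
      by have := enorm_triangle x (x + t *: xi) z; rewrite sx; lra.
    have := h1 (x + t *: xi); rewrite sx Fx subr0 ltr_pdivlMr // => k1.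
    by rewrite mulrC; apply: k1; lra.
  have [d d0 hd] := ok.
  have g0 : g 0 = x.
    have [|_] := hd 0; first by rewrite normr0.
    rewrite scale0r addr0 Fx enorm0 mulr0 => h.
    apply/eqP; rewrite -subr_eq0; apply/eqP/enorm_eq0/eqP.
    by rewrite eq_le h enorm_ge0.
  exists g; split; first by split=> //; exists d => // t /hd[].
  move=> e e0; rewrite g0.
  have x1 : 0 < enorm xi + 1 by have := enorm_ge0 xi; lra.
  have [|d1 d10 h1] := FJ x xr' (e / C / (enorm xi + 1)).
    by rewrite !divr_gt0.
  have [||s [s0 s1 hs]] := @small_step _ d1 (enorm xi); rewrite ?enorm_ge0 //.
  exists (Num.min d s); first by rewrite lt_min d0.
  move=> t; rewrite lt_min => /andP[/hd[_ k1] ts].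
  have ts' : `|t| * enorm xi <= s * enorm xi by rewrite ler_wpM2r ?enorm_ge0 ?ltW.
  have := h1 (x + t *: xi); rewrite sx Fx subr0 => /(_ (le_lt_trans ts' hs)).
  rewrite (_ : (x + t *: xi - x) *m J x = 0); last first.
    by rewrite addrC addKr -scalemxAl xiJ scaler0.
  rewrite subr0 => k2; rewrite -addrA -opprD; apply: le_trans k1 _.
  rewrite mulrC -ler_pdivlMr //; apply: le_trans k2 _.
  rewrite (_ : e * `|t| / C = e / C / (enorm xi + 1) * (`|t| * (enorm xi + 1))).
    by rewrite ler_wpM2l ?ler_wpM2l ?lerDl // ltW // !divr_gt0.
  by field; rewrite !gt_eqF.
Qed.

(** Inner semicontinuity of tangent spaces. The vector [xi] is corrected along the range of [K] into
    the kernel of [J x]; the correction [eta] is small because [xi *m J x] is. *)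
Lemma tangent_approx : chart M z r F J K -> M z -> forall xi, tangent M z xi ->
  forall e : R, 0 < e -> exists2 d : R, 0 < d & forall x, M x ->
    enorm (x - z) < d -> exists2 xi', tangent M x xi' & enorm (xi - xi') < e.
Proof.
move=> ch Mz xi; have := ch => -[r0 FJ MF KJ Jc].
rewrite (tangent_kernel ch) ?subrr ?enorm0 ?divr_gt0 // => xiJ e e0.
have [||s [s0 _ hs]] := @small_step _ e (enorm xi * (2 * fnorm K)) => //.
  by rewrite !mulr_ge0 ?enorm_ge0 ?fnorm_ge0.
have [d d0 hd] := Jc s s0.
exists (Num.min d (r / 2)); first by rewrite lt_min d0 divr_gt0.
move=> x Mx; rewrite lt_min => /andP[/hd k1 k2].
have xr : enorm (x - z) < r by lra.
pose A := K *m J x.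
(* [A] moves each vector by at most half its length, so it is injective and its inverse has norm at
   most 2. *)
have hA l : enorm l <= 2 * enorm (l *m A).
  have := KJ x xr l; rewrite -mulmxA -/A.
  by have := enorm_le_triangle l (l *m A); rewrite (enormBC l); lra.
have uA : A \in unitmx.
  rewrite -row_free_unit; apply: inj_row_free => l lA.
  apply: enorm_eq0; apply/eqP; rewrite eq_le enorm_ge0 andbT.
  by have := hA l; rewrite lA enorm0 mulr0.
pose eta := xi *m J x *m invmx A *m K.
exists (xi - eta).
  apply/(tangent_kernel ch) => //.
  by rewrite mulmxBl /eta -(mulmxA _ K) mulmxKV // subrr.
rewrite opprB addrC subrK; apply: le_lt_trans hs.
apply: le_trans (enorm_mulmx _ _) _.
have -> : s * (enorm xi * (2 * fnorm K)) = 2 * (enorm xi * s) * fnorm K by ring.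
rewrite ler_wpM2r ?fnorm_ge0 //.
apply: le_trans (hA _) _; rewrite mulmxKV // ler_wpM2l //.
have -> : xi *m J x = xi *m (J x - J z) by rewrite mulmxBr xiJ subr0.
apply: le_trans (enorm_mulmx _ _) _.
by rewrite ler_wpM2l ?enorm_ge0 // ltW.
Qed.

End Chart.

(** By [tangent_approx] a tangent vector at [z] is close to some tangent vector at [xs j], to which
    [us j] is orthogonal; both errors vanish in the limit. *)
Lemma normal_limit M z xs us u : C1_manifold M -> M z ->
  (forall j, M (xs j)) -> vcvg xs z -> (forall j, normal M (xs j) (us j)) ->
  vcvg us u -> normal M z u.
Proof.
move=> Mm Mz Mxs xsz nus usu xi xiT.
have [r [m [F [J [K ch]]]]] := chart_exists Mm Mz.
apply/eqP; rewrite -normr_eq0 eq_le normr_ge0 andbT.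
suff he (e : R) : 0 < e -> `|dot u xi| <= 0 + e by apply/ler_addgt0Pr.
move=> e0; rewrite add0r.
have x1 : 0 < enorm xi + 1 by have := enorm_ge0 xi; lra.
have u1 : 0 < enorm u + 1 by have := enorm_ge0 u; lra.
have [|d d0 hd] := tangent_approx ch Mz xiT (_ : 0 < e / 2 / (enorm u + 1)).
  by rewrite !divr_gt0.
have [N1 h1] := xsz d d0.
have [|N2 h2] := usu (Num.min 1 (e / 2 / (enorm xi + 1))).
  by rewrite lt_min ltr01 !divr_gt0.
pose j := maxn N1 N2.
have [xi' xi'T k1] := hd _ (Mxs j) (h1 j (leq_maxl _ _)).
have := h2 j (leq_maxr _ _); rewrite lt_min => /andP[k2 k3].
have -> : dot u xi = dot (u - us j) xi + dot (us j) (xi - xi').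
  by rewrite dotBr (nus j _ xi'T) dotBl; ring.
apply: le_trans (ler_normD _ _) _.
have := dot_norm_le (u - us j) xi; have := dot_norm_le (us j) (xi - xi').
have k4 : enorm (us j) <= enorm u + 1.
  by have := enorm_le_triangle (us j) u; lra.
have k5 : enorm (us j) * enorm (xi - xi') <= e / 2.
  apply: le_trans (_ : (enorm u + 1) * (e / 2 / (enorm u + 1)) <= _).
    by rewrite ler_pM ?enorm_ge0 // ltW.
  by rewrite mulrC divfK // gt_eqF.
have k6 : enorm (u - us j) * enorm xi <= e / 2.
  rewrite enormBC.
  apply: le_trans (_ : (e / 2 / (enorm xi + 1)) * (enorm xi + 1) <= _).
    rewrite ler_pM ?enorm_ge0 //; first exact: ltW.
    by rewrite lerDl.
  by rewrite divfK // gt_eqF.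
by move: k5 k6; lra.
Qed.

(** [p] is a nearest point of a closed piece of [M]; first-order optimality along curves through [p]
    says that [x - p] is normal. *)
Lemma projection_normal M z : C1_manifold M -> M z ->
  exists2 r : R, 0 < r & forall x, enorm (x - z) < r -> exists p,
    [/\ M p, enorm (p - z) <= 2 * enorm (x - z) & normal M p (x - p)].
Proof.
move=> Mm Mz; have [r [m [F [J [K ch]]]]] := chart_exists Mm Mz.
have := ch => -[r0 _ _ _ _].
(* This puts [p] within [r / 4] of [z], so short curves in [M] through [p] stay in the ball of
   radius [r / 2] over which [p] is nearest. *)
exists (r / 8); first by rewrite divr_gt0.
move=> x xr.
have [||p [Mp /= pr] hp] := @nearest_point _ _ (M `&` [set y | enorm (y - z) <= r / 2]) x.
- by exists z; split=> //=; rewrite subrr enorm0 divr_ge0 // ltW.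
- move=> u y hu uy; have yr : enorm (y - z) <= r / 2.
    suff he (e : R) : 0 < e -> enorm (y - z) <= r / 2 + e by apply/ler_addgt0Pr.
    move=> /uy[N /(_ N (leqnn N)) hN]; have [_ /=] := hu N.
    by have := enorm_triangle (u N) y z; rewrite (enormBC y (u N)); lra.
  split=> //; apply: (chart_closed ch _ _ uy); last by lra.
  by move=> j; case: (hu j).
have hz : enorm (x - p) <= enorm (x - z).
  by apply: hp; split=> //=; rewrite subrr enorm0 divr_ge0 // ltW.
have pz : enorm (p - z) <= 2 * enorm (x - z).
  by have := enorm_triangle x p z; rewrite (enormBC p x); lra.
exists p; split=> // xi [g [[g0 [d0 d00 hd0]] gxi]].
have [|d1 d10 h1] := curve_vel_near gxi (_ : 0 < r / 4); first by rewrite divr_gt0.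
have [d2 d20 h2] := curve_vel_lipschitz gxi.
apply: little_o_eq0 => e e0; have n0 := enorm_ge0 (x - p).
have p1 : 0 < enorm (x - p) + 1 by lra.
have [|d3 d30 h3] := gxi (e / 2 / (enorm (x - p) + 1)); first by rewrite !divr_gt0.
have [||s [s0 s1 hs]] := @small_step _ e ((enorm xi + 1) ^+ 2); rewrite ?sqr_ge0 //.
exists (Num.min (Num.min d0 d1) (Num.min d2 (Num.min d3 s))).
  by rewrite !lt_min d00 d10 d20 d30.
move=> t; rewrite !lt_min => /and4P[/andP[/hd0 Mg /h1 k1] /h2 k2 /h3 k3 ts].
rewrite g0 in k1 k2 k3.
have hh : 2 * dot (x - p) (g t - p) <= enorm (g t - p) ^+ 2.
  have : enorm (x - p) ^+ 2 <= enorm (x - g t) ^+ 2.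
    rewrite ler_pXn2r ?nnegrE ?enorm_ge0 //; apply: hp; split=> //=.
    by have := enorm_triangle p (g t) z; lra.
  have -> : x - g t = (x - p) - (g t - p) by rewrite opprB addrA subrK.
  rewrite !enorm_sqr [X in _ <= X]dotBl !(dotBr _ (x - p)) (dotC (g t - p)).
  by lra.
have k4 : enorm (g t - p) ^+ 2 <= e * `|t|.
  apply: le_trans (_ : ((enorm xi + 1) * `|t|) ^+ 2 <= _).
    by rewrite ler_pXn2r ?nnegrE ?enorm_ge0 // mulr_ge0 // addr_ge0 ?enorm_ge0.
  rewrite exprMn expr2 [`|t| ^+ 2]expr2 mulrA ler_wpM2r // -expr2.
  by apply: le_trans (ltW hs); rewrite mulrC ler_wpM2r ?sqr_ge0 // ltW.
have -> : t * dot (x - p) xi = dot (x - p) (g t - p) - dot (x - p) (g t - p - t *: xi).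
  by rewrite [dot _ (g t - p - _)]dotBr dotZr; ring.
have := dot_norm_le (x - p) (g t - p - t *: xi).
have k5 : enorm (x - p) * enorm (g t - p - t *: xi) <= e / 2 * `|t|.
  apply: le_trans (ler_wpM2l n0 k3) _.
  rewrite mulrA ler_wpM2r // mulrC mulrAC ler_pdivrMr // ler_wpM2l //; last by lra.
  by rewrite divr_ge0 // ltW.
by rewrite ler_norml => /andP[k6 _]; lra.
Qed.

End Manifold.

(** * Subgradients and identification *)

Section Subgradients.
Variables (R : realType) (n : nat).
Notation V := 'rV[R]_n.
Implicit Types (f : V -> \bar R) (M : set V) (x y z v xi : V).

Lemma fsub_lsub f x v : fsub f x v -> lsub f x v.
Proof.
move=> fv; split; first by case: fv.
exists (fun=> x), (fun=> v); do 3?split; try exact: vcvg_const.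
by move=> e e0; exists 0%N => j _; rewrite subrr normr0.
by [].
Qed.

Lemma fsub_closed f x : vclosed (fsub f x).
Proof.
move=> u y fu uy; split; first by case: (fu 0%N).
move=> e e0; have e20 : 0 < e / 2 by rewrite divr_gt0.
have [N /(_ N (leqnn N)) hN] := uy _ e20.
have [_ /(_ _ e20)[d d0 hd]] := fu N.
exists d => // z /hd; apply: le_trans; rewrite lee_fin.
have := dot_le (y - u N) (z - x); rewrite dotBl enormBC.
have := enorm_ge0 (z - x); nra.
Qed.

Lemma fsub_convex f x v w s : 0 <= s <= 1 -> fsub f x v -> fsub f x w ->
  fsub f x (v + s *: (w - v)).
Proof.
move=> /andP[s0 s1] [fx fv] [_ fw]; split=> // e e0.
have [d d0 hd] := fv e e0; have [d' d'0 hd'] := fw e e0.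
exists (Num.min d d'); first by rewrite lt_min d0.
move=> z; rewrite lt_min => /andP[/hd hv /hd' hw].
rewrite dotDl dotZl dotBl.
case: (lerP (dot w (z - x)) (dot v (z - x))) => h.
  by apply: le_trans hv; rewrite lee_fin; nra.
by apply: le_trans hw; rewrite lee_fin; nra.
Qed.

Lemma nearest_convex (A : set V) x p :
  (forall v w (s : R), 0 <= s <= 1 -> A v -> A w -> A (v + s *: (w - v))) ->
  A p -> (forall z, A z -> enorm (x - p) <= enorm (x - z)) ->
  forall z, A z -> dot (x - p) (z - p) <= 0.
Proof.
move=> cA Ap hp z Az; rewrite leNgt; apply/negP => c0.
have [s [s0 s1 hs]] := small_step c0 (sqr_ge0 (enorm (z - p))).
have s01 : 0 <= s <= 1 by rewrite ltW.
have : enorm (x - p) ^+ 2 <= enorm (x - (p + s *: (z - p))) ^+ 2.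
  by rewrite ler_pXn2r ?nnegrE ?enorm_ge0 //; apply: hp; apply: cA.
rewrite opprD addrA !enorm_sqr [X in _ <= X]dotBl !(dotBr _ (x - p)).
rewrite !dotZr !dotZl (dotC (z - p)) -(enorm_sqr (z - p)) => h.
have : s * (2 * dot (x - p) (z - p)) <= s * (s * enorm (z - p) ^+ 2) by lra.
by rewrite ler_pM2l //; lra.
Qed.

(** The Fréchet inequality is one-sided, but [f] is differentiable along the curve with slope [a];
    letting [t] take both signs forces equality. *)
Lemma fsub_curve f x v (g : R -> V) xi a : fsub f x v -> g 0 = x ->
  curve_vel g xi ->
  (forall e : R, 0 < e -> exists2 d : R, 0 < d & forall t : R, `|t| < d ->
     f (g t) \is a fin_num /\
     `|fine (f (g t)) - fine (f x) - t * a| <= e * `|t|) ->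
  dot v xi = a.
Proof.
move=> [_ fv] g0 gxi fa; apply/eqP; rewrite -subr_eq0; apply/eqP.
apply: little_o_eq0 => e e0.
have xi1 : 0 < enorm xi + 1 by have := enorm_ge0 xi; lra.
have v1 : 0 < enorm v + 1 by have := enorm_ge0 v; lra.
have [|d1 d10 h1] := fa (e / 3); first by rewrite divr_gt0.
have [|d2 d20 h2] := fv (e / 3 / (enorm xi + 1)); first by rewrite !divr_gt0.
have [|d3 d30 h3] := gxi (e / 3 / (enorm v + 1)); first by rewrite !divr_gt0.
have [d4 d40 h4] := curve_vel_lipschitz gxi.
have [d5 d50 h5] := curve_vel_near gxi d20.
exists (Num.min (Num.min d1 d3) (Num.min d4 d5)).
  by rewrite !lt_min d10 d30 d40.
move=> t; rewrite !lt_min => /andP[/andP[/h1[fin k1] /h3 k3] /andP[/h4 k4 /h5]].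
rewrite g0 in k3 k4 *; move=> /h2.
rewrite -(fineK fin) lee_fin => k2.
have k5 : e / 3 / (enorm xi + 1) * enorm (g t - x) <= e / 3 * `|t|.
  rewrite (le_trans (ler_wpM2l _ k4)) ?mulrA ?divfK ?gt_eqF //.
  by rewrite ltW // !divr_gt0.
have k6 : enorm v * enorm (g t - x - t *: xi) <= e / 3 * `|t|.
  rewrite (le_trans (ler_wpM2l (enorm_ge0 _) k3)) // mulrA ler_wpM2r //.
  by rewrite mulrC mulrAC ler_pdivrMr // ler_wpM2l //; lra.
have := dot_norm_le v (g t - x - t *: xi).
rewrite [dot v (g t - x - _)]dotBr dotZr => k7.
move: k1 k7; rewrite !ler_norml => /andP[k1 k1'] /andP[k7 k7'].
by move: k5 k6 k1' k2 k7; lra.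
Qed.

Lemma rgrad_fsub f M x g v xi : is_rgrad f M x g -> fsub f x v ->
  tangent M x xi -> dot v xi = dot g xi.
Proof.
move=> [_ hg] fv [c [[c0 cM] cxi]]; have [[d d0 hfin] hd] := hg c xi (conj c0 cM) cxi.
apply: (fsub_curve fv c0 cxi) => e /hd[d' d'0 hd'].
exists (Num.min d d'); first by rewrite lt_min d0.
by move=> t; rewrite lt_min => /andP[/hfin ? /hd' ?].
Qed.

Lemma par_aff (A : set V) u : A 0 -> par A u -> aff A u.
Proof.
move=> A0 [k [c [l [Ac [l0 ->]]]]].
(* The point [0] is added with weight 1: this raises the sum of the weights from 0 to 1 without
   changing the combination. *)
exists k.+1, (fun i => oapp c 0 (unlift ord0 i)), (fun i => oapp l 1 (unlift ord0 i)).
split; first by move=> i; case: unlift => //=.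
rewrite !big_ord_recl unlift_none /= scaler0 add0r; split.
  by rewrite (eq_bigr l) => [|i _]; rewrite ?l0 ?addr0 // liftK.
by apply: eq_bigr => i _; rewrite liftK.
Qed.

Lemma parZ (A : set V) u (s : R) : par A u -> par A (s *: u).
Proof.
move=> [k [c [l [Ac [l0 ->]]]]]; exists k, c, (fun i => s * l i); split=> //.
split; first by rewrite -mulr_sumr l0 mulr0.
by rewrite scaler_sumr; apply: eq_bigr => i _; rewrite scalerA.
Qed.

(* Compactness of the unit normals makes inner semicontinuity uniform: near [z],
   every subdifferential comes [eta]-close to every normal vector of length [e]. *)
Lemma ri_uniform f M z : C1_manifold M -> partly_smooth f M z ->
  ri (lsub f z) 0 ->
  exists2 e0 : R, 0 < e0 & forall e eta : R, 0 < e -> e < e0 -> 0 < eta ->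
    exists2 d : R, 0 < d & forall x u, M x -> enorm (x - z) < d ->
      normal M x u -> enorm u = 1 ->
      exists2 y, lsub f x y & enorm (y - e *: u) < eta.
Proof.
move=> Mm [Mz [_ [_ [parN isc]]]] [L0 [e0 e00 he0]]; exists e0 => // e eta ep ee0 eta0.
(* Failure of uniformity yields bad pairs at distance below [j.+1%:R^-1]; their unit normals cluster
   at a normal [u] of [M] at [z]. *)
apply: contrapT => H.
have step (j : nat) : exists xu : V * V,
    [/\ M xu.1, enorm (xu.1 - z) < j.+1%:R^-1, normal M xu.1 xu.2,
        enorm xu.2 = 1 & forall y, lsub f xu.1 y -> eta <= enorm (y - e *: xu.2)].
  apply: contrapT => H2; apply: H; exists j.+1%:R^-1; first by rewrite invr_gt0.
  move=> x u Mx xz nu u1; apply: contrapT => H3; apply: H2; exists (x, u).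
  split=> // y Ly; rewrite leNgt; apply/negP => hy; apply: H3; by exists y.
have [h hh] := choice step.
have [|p [u [hp uu]]] := @bolzano_weierstrass _ _ (fun j => (h j).2) 1.
  by move=> j; case: (hh j) => _ _ _ -> _.
have xz : vcvg (fun j => (h (p j)).1) z.
  by apply: (@vcvg_sub _ _ (fun j => (h j).1) z p hp); apply: vcvg_inv => j; case: (hh j).
have Mx j : M (h (p j)).1 by case: (hh (p j)).
have Nu : normal M z u.
  have Nj j : normal M (h (p j)).1 (h (p j)).2 by case: (hh (p j)).
  exact: normal_limit Mm Mz Mx xz Nj uu.
have u1 : enorm u <= 1.
  suff he (s : R) : 0 < s -> enorm u <= 1 + s by apply/ler_addgt0Pr.
  move=> /uu[N /(_ N (leqnn N))]; rewrite enormBC.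
  have := enorm_le_triangle u (h (p N)).2; case: (hh (p N)) => _ _ _ -> _; lra.
(* By sharpness [e *: u] is parallel to the subdifferential, and its norm is below the radius [e0]
   given by the relative interior. Inner semicontinuity then approximates it along the sequence,
   contradicting the choice of the pairs. *)
have Leu : lsub f z (e *: u).
  apply: he0; first by apply: par_aff => //; apply: parZ; rewrite parN.
  rewrite subr0 enormZ gtr0_norm //; apply: le_lt_trans ee0.
  by rewrite ler_piMr // ltW.
have [ys [Lys yse]] := isc _ Leu _ Mx xz.
have [|N1 h1] := yse (eta / 2); first by rewrite divr_gt0.
have [|N2 h2] := uu (eta / 2 / e); first by rewrite !divr_gt0.
pose j := maxn N1 N2.
have k1 := h1 j (leq_maxl _ _); have := h2 j (leq_maxr _ _).
rewrite ltr_pdivlMr // => k2.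
have [_ _ _ _ /(_ _ (Lys j))] := hh (p j).
have := enorm_triangle (e *: u) (ys j) (e *: (h (p j)).2).
by rewrite -scalerBr enormZ gtr0_norm // (enormBC u); lra.
Qed.

Lemma rgrad_lsub f M z : C1_manifold M -> partly_smooth f M z ->
  ri (lsub f z) 0 ->
  exists2 d : R, 0 < d & forall x g, M x -> enorm (x - z) < d ->
    is_rgrad f M x g -> lsub f x g.
Proof.
move=> Mm ps r0; have [e0 e00 he0] := ri_uniform Mm ps r0.
case: ps => _ [[r1 r10 h1] _].
(* With these values the product of [g - w] and [y - w] is at least [D ^+ 2 + D * (e0 / 4)], against
   the obtuse angle at the nearest point [w]. *)
have [|||d d0 hd] := he0 (e0 / 2) (e0 / 4); [lra..|].
exists (Num.min d r1); first by rewrite lt_min d0.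
move=> x g Mx; rewrite lt_min => /andP[xd /(h1 x Mx)[fl ln]] hg.
rewrite -fl in ln *.
have [w fw hw] := nearest_point g ln (@fsub_closed f x).
have [->//|gw] := eqVneq g w; exfalso.
have D0 : 0 < enorm (g - w) by rewrite enorm_gt0 // subr_eq0.
set D := enorm (g - w) in D0.
have gwN : normal M x (g - w).
  by move=> xi txi; rewrite dotBl (rgrad_fsub hg fw txi) subrr.
have uN : normal M x (D^-1 *: (g - w)).
  by move=> xi txi; rewrite dotZl gwN // mulr0.
have u1 : enorm (D^-1 *: (g - w)) = 1.
  by rewrite enormZ gtr0_norm ?invr_gt0 // mulVf // gt_eqF.
have [y] := hd x _ Mx xd uN u1; rewrite -fl => fy hy.
have := nearest_convex (fun v w' s => @fsub_convex f x v w' s) fw hw fy.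
have -> : y - w = (y - (e0 / 2) *: (D^-1 *: (g - w))) +
   ((e0 / 2 / D + 1) *: (g - w) - g).
  rewrite scalerDl scale1r scalerA -[_ + (g - w) - g]addrA subrKA.
  by rewrite (addrAC g) subrr add0r.
have gw0 : dot (g - w) g = 0 by apply: gwN; case: hg.
rewrite dotDr [dot _ (_ *: _ - g)]dotBr dotZr gw0.
rewrite subr0 -enorm_sqr -/D mulrDl mul1r.
have := dot_norm_le (g - w) (y - (e0 / 2) *: (D^-1 *: (g - w))).
have -> : e0 / 2 / D * D ^+ 2 = D * (e0 / 2) by field; rewrite gt_eqF.
rewrite -/D ler_norml => /andP[k1 _].
have k2 : D * enorm (y - (e0 / 2) *: (D^-1 *: (g - w))) <= D * (e0 / 4).
  by rewrite ler_wpM2l // ltW.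
have := mulr_gt0 D0 e00; have : 0 < D ^+ 2 by rewrite exprn_gt0.
by lra.
Qed.

(** Provides, at points of [M], the bound on function values required by prox-regularity. *)
Lemma restr_C1_continuous f M z : M z -> restr_C1 f M z ->
  forall e : R, 0 < e -> exists2 d : R, 0 < d & forall x, M x ->
    enorm (x - z) < d -> (f x < f z + e%:E)%E.
Proof.
move=> Mz [r [g [J [r0 [gJ fg]]]]] e e0.
have [|gz _] := gJ z; first by rewrite subrr enorm0.
have [d d0 hd] := has_deriv_continuous gz e0.
exists (Num.min d r); first by rewrite lt_min d0.
move=> x Mx; rewrite lt_min => /andP[/hd h1 xr].
rewrite !fg // ?subrr ?enorm0 // -EFinD lte_fin.
have := coord_le_enorm (g x - g z) ord0; rewrite !mxE ler_norml => /andP[_].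
by lra.
Qed.

(** The core of identification, for Fréchet subgradients since prox-regularity speaks of these.
    Closeness of [f x] to [f z] is assumed here and obtained from subdifferential continuity in
    [identification]. *)
Lemma identification_frechet f M z : C1_manifold M -> partly_smooth f M z ->
  ri (lsub f z) 0 -> prox_regular_at f z 0 ->
  exists2 d : R, 0 < d & forall x v, enorm (x - z) < d -> fsub f x v ->
    enorm v < d -> (f x < f z + d%:E)%E -> M x.
Proof.
move=> Mm ps r0 [eps [rho [eps0 [rho0 prox]]]].
have [e0 e00 he0] := ri_uniform Mm ps r0.
have [Mz [[r1 r10 h1] [fC1 _]]] := ps.
(* The bound [2 * e <= eps] admits in prox-regularity every [y] within [e / 2] of a vector of length
   [e]. *)
have [e [ep ee0 eeps]] : exists e : R, [/\ 0 < e, e < e0 & 2 * e <= eps].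
  have m0 : 0 < Num.min e0 eps by rewrite lt_min e00.
  exists (Num.min e0 eps / 2).
  have : Num.min e0 eps <= e0 by rewrite ge_min lexx.
  have : Num.min e0 eps <= eps by rewrite ge_min lexx orbT.
  by split; lra.
have [|||d1 d10 hd1] := he0 e (e / 2); [by lra..|].
have [r2 r20 h2] := projection_normal Mm Mz.
have [r3 r30 h3] := restr_C1_continuous Mz fC1 eps0.
(* The distance [D] from [x] to [p] will be at most [3 * s], so this gives [rho * D < e / 4]. *)
have [||s [s0 s1 hs]] := @small_step _ (e / 4) (3 * rho); [lra..|].
have [d d0] : exists2 d : R, 0 < d &
    4 * d <= Num.min (Num.min (e / 4) s) (Num.min (Num.min r1 r2) (Num.min d1 r3)).
  exists (Num.min (Num.min (e / 4) s) (Num.min (Num.min r1 r2) (Num.min d1 r3)) / 4).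
    by rewrite divr_gt0 // !lt_min s0 r10 r20 d10 r30 !andbT divr_gt0.
  by rewrite mulrC divfK.
rewrite !le_min => /andP[/andP[de ds] /andP[/andP[dr1 dr2] /andP[dd1 dr3]]].
exists d => // x v xz fv vd fx.
have [|p [Mp pz pN]] := h2 x; first by lra.
have [xp|xp] := eqVneq x p; first by rewrite xp.
have D0 : 0 < enorm (x - p) by rewrite enorm_gt0 // subr_eq0.
have D3 := enorm_triangle z x p; rewrite (enormBC z) in D3.
set D := enorm (x - p) in D0 D3.
have [|fl _] := h1 p Mp; first by lra.
have uN : normal M p (D^-1 *: (x - p)).
  by move=> xi txi; rewrite dotZl pN // mulr0.
have u1 : enorm (D^-1 *: (x - p)) = 1.
  by rewrite enormZ gtr0_norm ?invr_gt0 // mulVf // gt_eqF.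
have [|y] := hd1 p _ Mp _ uN u1; first by lra.
rewrite -fl => fy hy.
have ny : enorm y < eps.
  have := enorm_le_triangle y (e *: (D^-1 *: (x - p))).
  by rewrite (enormZ e) u1 gtr0_norm //; lra.
have [fx_fin _] := fv; have [fp_fin _] := fy.
have := prox p x y; rewrite subr0 => /(_ ltac:(lra) ltac:(lra) fy ny).
rewrite h3 //; last by lra.
rewrite -(fineK fx_fin) lee_fin -/D => /(_ isT) k1.
have fxe : (f x < f z + eps%:E)%E.
  apply: lt_le_trans fx _; apply: leeD => //; rewrite lee_fin; lra.
have := prox x p v; rewrite subr0 => /(_ ltac:(lra) ltac:(lra) fv ltac:(lra) fxe).
rewrite -(fineK fp_fin) lee_fin (enormBC p) -/D -(opprB x p) dotNr => k2.
exfalso.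
(* Adding [k1] and [k2] cancels the function values. The pairing of [x - p] with [y] is at least
   [D * (e / 2)] and that with [v] at most [D * (e / 4)], so [e / 4 <= rho * D], a contradiction. *)
have k3 := dot_le v (x - p); rewrite -/D in k3.
have := dot_norm_le (y - e *: (D^-1 *: (x - p))) (x - p).
rewrite dotBl !dotZl -enorm_sqr -/D => k4.
have k5 : enorm (y - e *: (D^-1 *: (x - p))) * D <= e / 2 * D.
  by rewrite ler_wpM2r // ltW.
have {}k4 : D * (e / 2) <= dot y (x - p).
  move: k4; rewrite (_ : e * (D^-1 * D ^+ 2) = D * e); last by field; rewrite gt_eqF.
  by rewrite ler_norml => /andP[k4 _]; lra.
have k6 : enorm v * D <= e / 4 * D by rewrite ler_wpM2r //; lra.
have k7 : D * (e / 4) <= D * (rho * D) by lra.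
have : rho * D < e / 4.
  apply: le_lt_trans hs; rewrite (_ : s * (3 * rho) = rho * (3 * s)); last by ring.
  by rewrite ler_wpM2l //; lra.
by move: k7; rewrite ler_pM2l //; lra.
Qed.

(** The sequential property at the subgradient [0], put in neighbourhood form by contradiction. *)
Lemma subdiff_continuous_near f z : subdiff_continuous f z -> lsub f z 0 ->
  forall e : R, 0 < e -> exists2 d : R, 0 < d & forall x v,
    enorm (x - z) < d -> lsub f x v -> enorm v < d ->
    `|fine (f x) - fine (f z)| < e.
Proof.
move=> sc L0 e e0; apply: contrapT => H.
have step (j : nat) : exists xv : V * V,
    [/\ enorm (xv.1 - z) < j.+1%:R^-1, lsub f xv.1 xv.2, enorm xv.2 < j.+1%:R^-1
      & e <= `|fine (f xv.1) - fine (f z)|].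
  apply: contrapT => H2; apply: H; exists j.+1%:R^-1; first by rewrite invr_gt0.
  move=> x v xz Lv vj; rewrite ltNge; apply/negP => H3; apply: H2.
  by exists (x, v).
have [h hh] := choice step.
have [|||N /(_ N (leqnn N))] := sc (fun j => (h j).1) (fun j => (h j).2) 0 _ _ _ L0 e e0.
- by apply: vcvg_inv => j; case: (hh j).
- by move=> j; case: (hh j).
- by apply: vcvg_inv => j; rewrite subr0; case: (hh j).
by case: (hh N) => _ _ _; rewrite leNgt => /negP.
Qed.

(** A limiting subgradient is approached by Fréchet pairs with converging function values. These
    pairs lie on [M] by [identification_frechet], and [M] is closed inside a chart. *)
Lemma identification f M z : C1_manifold M -> partly_smooth f M z ->
  ri (lsub f z) 0 -> prox_regular_at f z 0 -> subdiff_continuous f z ->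
  exists2 d : R, 0 < d & forall x v, enorm (x - z) < d -> lsub f x v ->
    enorm v < d -> M x.
Proof.
move=> Mm ps r0 prox sc.
have [d1 d10 h1] := identification_frechet Mm ps r0 prox.
have [L0 _] := r0; have [fz_fin _] := L0.
have [|d2 d20 h2] := subdiff_continuous_near sc L0 (_ : 0 < d1 / 2).
  by rewrite divr_gt0.
have [r [m [F [J [K ch]]]]] := chart_exists Mm ps.1; have [rp _ _ _ _] := ch.
exists (Num.min (d1 / 2) (Num.min d2 r)).
  by rewrite !lt_min d20 rp divr_gt0.
move=> x v; rewrite !lt_min => /and3P[x1 x2 xr] Lv /and3P[v1 v2 _].
have := h2 x v x2 Lv v2; rewrite ltr_norml => /andP[_ k2].
case: Lv => fx_fin [xs [vs [xsx [fxs [fvs vsv]]]]].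
have d120 : 0 < d1 / 2 by rewrite divr_gt0.
have [N1 hN1] := xsx _ d120; have [N2 hN2] := vsv _ d120.
have [N3 hN3] := fxs _ d120.
pose N := maxn N1 (maxn N2 N3).
(* Shifting the sequence by [N] puts all its terms, not only a tail, on [M]. *)
apply: (chart_closed ch _ xr (vcvg_sub (p := fun j => (j + N)%N) _ xsx)) => j;
  last exact: leq_addr.
have Nj : (N <= j + N)%N by rewrite leq_addl.
move: Nj; rewrite {1}/N !geq_max => /and3P[/hN1 q1 /hN2 q2 /hN3].
rewrite ltr_norml => /andP[_ q3].
apply: (h1 _ (vs (j + N)%N)) => //.
- by have := enorm_triangle x (xs (j + N)%N) z; lra.
- by have := enorm_le_triangle (vs (j + N)%N) v; lra.
- have [fin _] := fvs (j + N)%N.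
  by rewrite -(fineK fin) -(fineK fz_fin) -EFinD lte_fin; lra.
Qed.

(** The gradient is the orthogonal projection [g] of [v] onto the tangent space: [fsub_curve]
    identifies the slope of [f] along each curve with the pairing of its velocity with [v], hence
    with [g]. *)
Lemma rgrad_exists f M z : C1_manifold M -> partly_smooth f M z ->
  exists2 d : R, 0 < d & forall x v, M x -> enorm (x - z) < d -> lsub f x v ->
    exists2 g, is_rgrad f M x g & enorm g <= enorm v.
Proof.
move=> Mm [Mz [[r1 r10 h1] [[r2 [G [JG [r20 [GJ fG]]]]] _]]].
have [r [m [F [J [K ch]]]]] := chart_exists Mm Mz; have [rp _ _ _ _] := ch.
exists (Num.min (r / 2) (Num.min r1 r2)).
  by rewrite !lt_min r10 r20 divr_gt0.
move=> x v Mx; rewrite !lt_min => /and3P[xr x1 x2].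
have [<- _] := h1 x Mx x1; move=> fv.
have [GJx _] := GJ x x2.
pose A := [set xi : V | xi *m J x = 0].
have [||g Ag hg] := @nearest_point _ _ A v.
- by exists 0; rewrite /A /= mul0mx.
- move=> u y Au uy; apply: enorm_small => e e0.
  have [||s [s0 _ hs]] := @small_step _ e (fnorm (J x)); rewrite ?fnorm_ge0 //.
  have [N /(_ N (leqnn N)) hN] := uy s s0.
  have -> : y *m J x = (y - u N) *m J x by rewrite mulmxBl (Au N) subr0.
  apply: le_trans (enorm_mulmx _ _) (le_trans _ (ltW hs)).
  by rewrite enormBC ler_wpM2r ?fnorm_ge0 // ltW.
have Aconv w w' (s : R) : 0 <= s <= 1 -> A w -> A w' -> A (w + s *: (w' - w)).
  rewrite /A /= => _ wJ w'J.
  by rewrite mulmxDl -scalemxAl mulmxBl wJ w'J subrr scaler0 addr0.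
(* [A] is a linear subspace, so the variational inequality holds at [g + xi] and [g - xi], hence
   with equality. *)
have orth xi : A xi -> dot v xi = dot g xi.
  move=> Axi; apply/eqP; rewrite -subr_eq0 -dotBl eq_le.
  have AD : A (g + xi) by rewrite /A /= mulmxDl Ag Axi addr0.
  have AB : A (g - xi) by rewrite /A /= mulmxBl Ag Axi subrr.
  have := nearest_convex Aconv Ag hg AD; have := nearest_convex Aconv Ag hg AB.
  by rewrite (addrC g xi) (addrC g (- xi)) !addrK dotNr oppr_le0 => -> ->.
have fcurve (c : R -> V) xi : curve_in M x c -> curve_vel c xi ->
    forall e : R, 0 < e -> exists2 d : R, 0 < d & forall t : R, `|t| < d ->
    f (c t) \is a fin_num /\
    `|fine (f (c t)) - fine (f x) - t * (xi *m JG x) ord0 ord0| <= e * `|t|.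
  move=> [c0 [d3 d30 h3]] cxi e e0.
  have [d4 d40 h4] := has_deriv_curve GJx c0 cxi e0.
  have [|d5 d50 h5] := curve_vel_near cxi (_ : 0 < r2 - enorm (x - z)).
    by rewrite subr_gt0.
  exists (Num.min d3 (Num.min d4 d5)); first by rewrite !lt_min d30 d40.
  move=> t; rewrite !lt_min => /and3P[/h3 Mc /h4 k4 /h5]; rewrite c0 => k5.
  rewrite !fG //; last by have := enorm_triangle x (c t) z; lra.
  split=> //=; apply: le_trans k4.
  by have := coord_le_enorm (G (c t) - G x - t *: (xi *m JG x)) ord0; rewrite !mxE.
exists g.
  split; first by apply/(tangent_kernel ch).
  move=> c xi hc cxi.
  have txi : A xi by apply/(tangent_kernel ch) => //; exists c.
  have Ga := fsub_curve fv hc.1 cxi (fcurve c xi hc cxi).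
  split.
    have [d d0 hd] := fcurve c xi hc cxi 1 ltr01.
    by exists d => // t /hd[].
  move=> e e0; have [d d0 hd] := fcurve c xi hc cxi e e0.
  by exists d => // t /hd[_]; rewrite -orth // Ga.
have [->|g0] := eqVneq g 0; first by rewrite enorm0 enorm_ge0.
rewrite -(ler_pM2r (enorm_gt0 g0)); apply: le_trans (dot_le v g).
by rewrite orth // -enorm_sqr expr2.
Qed.

(** * Distances to sets and the equivalence of the two error bounds *)

Lemma dist_le x (A : set V) a : A a -> (dist x A <= (enorm (x - a))%:E)%E.
Proof. by move=> Aa; apply: ereal_inf_lbound; exists a. Qed.

Lemma le_dist x (A : set V) (c : \bar R) :
  (forall a, A a -> (c <= (enorm (x - a))%:E)%E) -> (c <= dist x A)%E.
Proof. by move=> h; apply/ereal_infP => _ [a Aa <-]; exact: h. Qed.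

Lemma dist_ge0 x (A : set V) : (0 <= dist x A)%E.
Proof. by apply: le_dist => a _; rewrite lee_fin enorm_ge0. Qed.

Lemma dist_subset x (A B : set V) : A `<=` B -> (dist x B <= dist x A)%E.
Proof. by move=> AB; apply: le_dist => a /AB; exact: dist_le. Qed.

Lemma argmin_lsub f x : proper_fun f -> argmin f x -> lsub f x 0.
Proof.
move=> [fNy [y0 fy0]] fx; apply: fsub_lsub.
have fin : f x \is a fin_num.
  rewrite fin_numE fNy /=; apply: contraTneq (fx y0) => ->.
  by rewrite leye_eq; apply: contraTneq fy0 => ->.
split=> // e e0; exists 1 => // y _; apply: le_trans (fx y).
rewrite -[leRHS](fineK fin) lee_fin dot0l addr0 gerBl.
by rewrite mulr_ge0 ?enorm_ge0 // ltW.
Qed.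

End Subgradients.

Theorem theorem6 (R : realType) (n : nat) (f : 'rV[R]_n -> \bar R)
    (M : set 'rV[R]_n) (xbar : 'rV[R]_n) :
  proper_fun f -> closed_fun f ->
  argmin f !=set0 -> argmin f xbar ->
  C1_manifold M -> M xbar ->
  around_rel (partly_smooth f M) M xbar ->
  around_rel (fun z => forall v, fsub f z v -> prox_regular_at f z v) M xbar ->
  ri (lsub f xbar) 0 ->
  subdiff_continuous f xbar ->
  ((exists eps mu : R, 0 < eps /\ 0 < mu /\
      forall x, enorm (x - xbar) < eps ->
        (mu%:E * dist x (argmin f) <= dist 0 (lsub f x))%E)
   <->
   (exists eps mu : R, 0 < eps /\ 0 < mu /\
      forall x, M x -> enorm (x - xbar) < eps ->
        forall g, is_rgrad f M x g ->
          (mu%:E * dist x (argmin f `&` M) <= (enorm g)%:E)%E)).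
Proof.
move=> fprop _ _ Sx Mm Mx [rp rp0 hps] [rq rq0 hprox] ri0 sc.
have xx : enorm (xbar - xbar) = 0 by rewrite subrr enorm0.
have ps : partly_smooth f M xbar by apply: hps; rewrite ?xx.
have prox : prox_regular_at f xbar 0.
  apply: hprox; rewrite ?xx //.
  by have [_ [[r r0 h] _]] := ps; have [|-> _] := h xbar Mx; [rewrite xx|exact: ri0.1].
have [d d0 hd] := identification Mm ps ri0 prox sc.
split=> [[eps [mu [eps0 [mu0 hmu]]]]|[eps [mu [eps0 [mu0 hmu]]]]].
- have [d' d'0 hd'] := rgrad_lsub Mm ps ri0.
  exists (Num.min (d / 2) (Num.min d' eps)), mu.
  split; first by rewrite !lt_min d'0 eps0 divr_gt0.
  split=> // x xM; rewrite !lt_min => /and3P[x1 x2 x3] g hg.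
  have h0 : (dist 0 (lsub f x) <= (enorm g)%:E)%E.
    by have := dist_le 0 (hd' x g xM x2 hg); rewrite sub0r enormN.
  apply: le_trans h0; apply: le_trans (hmu x x3).
  rewrite lee_pmul2l // ?lte_fin //; apply: le_dist => s Ss.
  (* A minimiser within [d] of [xbar] lies on [M] by identification. Any other is at least [d / 2]
     away from [x], so no nearer than [xbar], which belongs to both sets. *)
  have [sd|sd] := ltP (enorm (s - xbar)) d.
    apply: dist_le; split=> //; apply: (hd s 0) => //; last by rewrite enorm0.
    exact: argmin_lsub.
  apply: le_trans (dist_le _ (conj Sx Mx)) _; rewrite lee_fin.
  by have := enorm_triangle x s xbar; rewrite (enormBC s x); lra.
- have [d' d'0 hd'] := rgrad_exists Mm ps.
  exists (Num.min d (Num.min d' eps)), (Num.min 1 mu).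
  split; first by rewrite !lt_min d0 d'0.
  split; first by rewrite lt_min ltr01.
  move=> x; rewrite !lt_min => /and3P[x1 x2 x3].
  apply: le_dist => v Lv; rewrite sub0r enormN.
  (* A small [v] places [x] on [M], where the gradient bound applies with [mu]. A large one exceeds
     the distance from [x] to [xbar], so the constant 1 suffices. *)
  have [vd|vd] := ltP (enorm v) d.
    have xM := hd x v x1 Lv vd.
    have [g hg gv] := hd' x v xM x2 Lv.
    apply: (@le_trans _ _ (enorm g)%:E); last by rewrite lee_fin.
    apply: le_trans (hmu x xM x3 g hg).
    apply: lee_pmul; rewrite ?dist_ge0 ?lee_fin ?le_min ?ler01 ?(ltW mu0) //.
      by rewrite ge_min lexx orbT.
    by apply: dist_subset => y [].
  apply: (@le_trans _ _ (1%:E * dist x (argmin f))%E).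
    by apply: lee_wpmul2r; rewrite ?dist_ge0 // lee_fin ge_min lexx.
  rewrite mul1e; apply: le_trans (dist_le _ Sx) _.
  by rewrite lee_fin (le_trans (ltW x1)).
Qed.
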